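(* Let $A$ be a Banach algebra, let $X$ be a Banach $A$-bimodule, and let $Y$ be a closed submodule (sub-bimodule) of $X$. If $H^1(A,Y^* )=\{0\}$ and $H^1(A,(X/Y)^* )=\{0\}$, then $H^1(A,X^* )=\{0\}$.
   Context: A Banach $A$-bimodule is a Banach space that is an $A$-bimodule with jointly continuous module operations. For a Banach $A$-bimodule $X$, the dual $X^*$ is a Banach $A$-bimodule via $\langle x,a\cdot x^*\rangle=\langle x\cdot a,x^*\rangle$ and $\langle x,x^*\cdot a\rangle=\langle a\cdot x,x^*\rangle$. A derivation $D:A\to X$ is a continuous linear map with $D(ab)=a\cdot D(b)+D(a)\cdot b$ for all $a,b\in A$; it is inner if there is $x\in X$ with $D(a)=a\cdot x-x\cdot a$ for all $a\in A$. $H^1(A,X)=\{0\}$ means every derivation $A\to X$ is inner. *)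

(* Defs.v *)
From HB Require Import structures.
From mathcomp Require Import all_boot all_order all_algebra.
From mathcomp Require Import generic_quotient ring_quotient complex.
From mathcomp Require Import mathcomp_extra boolp classical_sets functions.
From mathcomp Require Import filter reals topology normedtype sequences.

Set Implicit Arguments.
Unset Strict Implicit.
Unset Printing Implicit Defensive.

Import Order.TTheory GRing.Theory Num.Theory.
Import numFieldNormedType.Exports.

Local Open Scope classical_set_scope.
Local Open Scope ring_scope.

Variant scalar_kind := RealScalars | ComplexScalars.

(* The ground field, either R or C = R[i]; norms of modules over R[i] take
   (nonnegative real) values in R[i]. *)
Definition scalars (R : realType) (k : scalar_kind) : numFieldType :=
  match k with RealScalars => R | ComplexScalars => R[i] end.

(* Not assumed unital, hence not an lalgType. *)
HB.mixin Record CompleteNormedModule_isBanachAlgebra (K : numFieldType) A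
    & CompleteNormedModule K A := {
  amul : A -> A -> A ;
  amulA : associative amul ;
  amulDl : left_distributive amul +%R ;
  amulDr : right_distributive amul +%R ;
  amulZl : forall (c : K) a b, amul (c *: a) b = c *: amul a b ;
  amulZr : forall (c : K) a b, amul a (c *: b) = c *: amul a b ;
  ler_norm_amul : forall a b, `|amul a b| <= `|a| * `|b|
}.

#[short(type="banachAlgType")]
HB.structure Definition BanachAlgebra (K : numFieldType) :=
  {A of CompleteNormedModule K A & CompleteNormedModule_isBanachAlgebra K A}.

HB.mixin Record CompleteNormedModule_isBanachBimodule (K : numFieldType)
    (A : banachAlgType K) X & CompleteNormedModule K X := {
  lact : A -> X -> X ;
  ract : X -> A -> X ;
  lactDl : forall a b x, lact (a + b) x = lact a x + lact b x ;
  lactDr : forall a x y, lact a (x + y) = lact a x + lact a y ;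
  lactZl : forall (c : K) a x, lact (c *: a) x = c *: lact a x ;
  lactZr : forall (c : K) a x, lact a (c *: x) = c *: lact a x ;
  ractDl : forall x y a, ract (x + y) a = ract x a + ract y a ;
  ractDr : forall x a b, ract x (a + b) = ract x a + ract x b ;
  ractZl : forall (c : K) x a, ract (c *: x) a = c *: ract x a ;
  ractZr : forall (c : K) x a, ract x (c *: a) = c *: ract x a ;
  lactA : forall a b x, lact (amul a b) x = lact a (lact b x) ;
  ractA : forall x a b, ract x (amul a b) = ract (ract x a) b ;
  lractA : forall a x b, ract (lact a x) b = lact a (ract x b) ;
  lact_continuous : continuous (fun p : A * X => lact p.1 p.2) ;
  ract_continuous : continuous (fun p : X * A => ract p.1 p.2)
}.

#[short(type="banachBimodType")]
HB.structure Definition BanachBimodule (K : numFieldType)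
    (A : banachAlgType K) :=
  {X of CompleteNormedModule K X & CompleteNormedModule_isBanachBimodule K A X}.

Section Cohomology.
Variables (K : numFieldType) (A : banachAlgType K) (X : banachBimodType A).

Definition derivation (D : {linear A -> X}) : Prop :=
  continuous D /\ forall a b, D (amul a b) = lact a (D b) + ract (D a) b.

Definition inner (D : A -> X) : Prop :=
  exists x : X, forall a, D a = lact a x - ract x a.

Definition H1_trivial : Prop :=
  forall D : {linear A -> X}, derivation D -> inner D.

End Cohomology.
Arguments H1_trivial {K} A X.

Section ScalarOrder.
Variables (R : realType) (k : scalar_kind).
Local Notation K := (scalars R k).

Lemma scalars_sup (E : set K) : E !=set0 -> (forall x, E x -> 0 <= x) ->
  ubound E !=set0 -> supremums E !=set0.
Proof.
case: k E => /= E [e Ee] E0 [u uE].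
  have hE : has_sup E by split; [exists e|exists u].
  exists (sup E); split; first exact: sup_upper_bound.
  by move=> y yE; apply: ge_sup => //; exists e.
pose F := [set complex.Re x | x in E].
have hF : has_sup F.
  split; first by exists (complex.Re e), e.
  by exists (complex.Re u) => _ [x Ex <-]; have := uE _ Ex; rewrite lecE => /andP[].
exists (real_complex R (sup F)); split.
  move=> x Ex; have := E0 _ Ex; rewrite !lecE /= => /andP[/eqP -> _].
  rewrite eqxx /=; apply: sup_upper_bound => //; by exists x.
move=> y yE; have := le_trans (E0 _ Ee) (yE _ Ee).
rewrite !lecE /= => /andP[/eqP -> _]; rewrite eqxx /=.
apply: ge_sup; first by exists (complex.Re e), e.
by move=> _ [x Ex <-]; have := yE _ Ex; rewrite lecE => /andP[].
Qed.

Lemma scalars_inf (E : set K) : E !=set0 -> (forall x, E x -> 0 <= x) ->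
  infimums E !=set0.
Proof.
move=> [e Ee] E0.
have [|||s [s1 s2]] := @scalars_sup (lbound E `&` [set x | 0 <= x]).
- by exists 0; split => //= x /E0.
- by move=> x [].
- by exists e => x [/(_ _ Ee)].
exists s; split; first by move=> x Ex; apply: s2 => y [/(_ _ Ex)].
move=> l lE; have rl : l \is Num.real.
  rewrite -[l](subKr e); apply: rpredB; apply: ger0_real; first exact: E0.
  by rewrite subr_ge0; exact: lE.
have s0 : 0 <= s by apply: s1; split => //= x /E0.
case: (@real_ge0P _ l rl) => l0; first exact: s1.
exact: le_trans (ltW l0) s0.
Qed.

End ScalarOrder.

Section BilinearMaps.
Variables (K : numFieldType) (U V W : normedModType K) (B : U -> V -> W).
Hypothesis BDl : forall u u' v, B (u + u') v = B u v + B u' v.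
Hypothesis BDr : forall u v v', B u (v + v') = B u v + B u v'.
Hypothesis BZl : forall c u v, B (c *: u) v = c *: B u v.
Hypothesis BZr : forall c u v, B u (c *: v) = c *: B u v.

Lemma bilinear_continuous_bounded : continuous (fun p : U * V => B p.1 p.2) ->
  exists2 C : K, 0 <= C & forall u v, `|B u v| <= C * (`|u| * `|v|).
Proof.
have B0l v : B 0 v = 0 by rewrite -(scale0r 0) BZl scale0r.
have B0r u : B u 0 = 0 by rewrite -(scale0r 0) BZr scale0r.
move=> /(_ (0, 0)) /cvgrPdist_lt /(_ 1 ltr01) /= [[P Q] /= [P0 Q0] PQ].
have /nbhs_norm0P [d /= d0 dP] := P0.
have /nbhs_norm0P [e /= e0 eQ] := Q0.
have d2 : 0 < d / 2 by rewrite divr_gt0.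
have e2 : 0 < e / 2 by rewrite divr_gt0.
have dd : d / 2 < d by rewrite ltr_pdivrMr// mulrDr mulr1 ltrDl.
have ee : e / 2 < e by rewrite ltr_pdivrMr// mulrDr mulr1 ltrDl.
exists (d / 2 * (e / 2))^-1; first by rewrite invr_ge0 mulr_ge0// ltW.
move=> u v.
have [->|u0] := eqVneq u 0; first by rewrite B0l !normr0 mul0r mulr0.
have [->|v0] := eqVneq v 0; first by rewrite B0r !normr0 !mulr0.
have nu : 0 < `|u| by rewrite normr_gt0.
have nv : 0 < `|v| by rewrite normr_gt0.
have := PQ ((d / 2 / `|u|) *: u, (e / 2 / `|v|) *: v); rewrite /= B0l sub0r normrN.
have cd : 0 < d / 2 / `|u| by rewrite divr_gt0.
have ce : 0 < e / 2 / `|v| by rewrite divr_gt0.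
have Pu : P ((d / 2 / `|u|) *: u).
  by apply: dP; rewrite /= normrZ gtr0_norm// divfK ?gt_eqF.
have Qv : Q ((e / 2 / `|v|) *: v).
  by apply: eQ; rewrite /= normrZ gtr0_norm// divfK ?gt_eqF.
move=> /(_ (conj Pu Qv)); rewrite BZl BZr (normrZ _ (_ *: _)) (normrZ _ (B u v)) (gtr0_norm cd) (gtr0_norm ce).
rewrite mulrA -ltr_pdivlMl; last by rewrite mulr_gt0.
rewrite mulr1 => /ltW/le_trans; apply.
by rewrite mulrACA invfM -(invfM `|u|) invrK.
Qed.

Lemma bilinear_bounded_continuous (C : K) :
  (forall u v, `|B u v| <= C * (`|u| * `|v|)) ->
  continuous (fun p : U * V => B p.1 p.2).
Proof.
move=> BC [u0 v0]; apply/cvgrPdist_lt => /= e e0.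
have [C' C'0 {}BC] : exists2 C', 0 <= C' & forall u v, `|B u v| <= C' * (`|u| * `|v|).
  exists `|C| => // u v; apply: le_trans (BC u v) _.
  have := BC u v; have [uv|uv] := eqVneq (`|u| * `|v|) 0; first by rewrite uv !mulr0.
  have uv0 : 0 < `|u| * `|v| by rewrite lt_def uv mulr_ge0.
  move=> /(le_trans (normr_ge0 _)); rewrite pmulr_lge0// => C0.
  by rewrite ger0_norm.
pose M := C' * (`|u0| + `|v0| + 1) + 1.
have M0 : 0 < M by rewrite ltr_wpDl// mulr_ge0// !addr_ge0.
have eM : 0 < e / 2 / M by rewrite !divr_gt0.
have BB u v : B u0 v0 - B u v = B (u0 - u) v0 + B u (v0 - v).
  have BNl x y : B (- x) y = - B x y by rewrite -scaleN1r BZl scaleN1r.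
  have BNr x y : B x (- y) = - B x y by rewrite -scaleN1r BZr scaleN1r.
  by rewrite BDl BDr BNl BNr addrA subrK.
have nu (d : K) : 0 < d -> \forall p \near (u0, v0), `|u0 - p.1| < d.
  by move=> d0; near=> p; near: p; apply: cvgr_dist_lt d0; exact: cvg_fst.
have nv (d : K) : 0 < d -> \forall p \near (u0, v0), `|v0 - p.2| < d.
  by move=> d0; near=> p; near: p; apply: cvgr_dist_lt d0; exact: cvg_snd.
near=> p; rewrite BB.
apply: le_lt_trans (ler_normD _ _) _.
apply: le_lt_trans (lerD (BC _ _) (BC _ _)) _.
have p1 : `|u0 - p.1| < 1 by near: p; exact: nu.
have p2 : `|u0 - p.1| < e / 2 / M by near: p; exact: nu.
have p3 : `|v0 - p.2| < e / 2 / M by near: p; exact: nv.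
have p4 : `|p.1| <= `|u0| + 1.
  rewrite -[p.1](subKr u0); apply: le_trans (ler_normB _ _) _.
  by rewrite lerD2l ltW.
have -> : e = M * (e / 2 / M) + M * (e / 2 / M).
  by rewrite -mulrDr -mulrDl -splitr mulrC divfK// gt_eqF.
apply: ler_ltD.
  rewrite mulrCA mulrC; apply: ler_pM => //; rewrite ?mulr_ge0 //; last exact: ltW.
  rewrite /M; apply: ler_wpDr => //; rewrite ler_wpM2l//.
  by rewrite -addrA addrCA lerDl addr_ge0.
rewrite mulrA; apply: (@le_lt_trans _ _ (C' * (`|u0| + `|v0| + 1) * `|v0 - p.2|)).
  rewrite ler_wpM2r// ler_wpM2l// (le_trans p4)// -addrA lerD2l lerDr//.
apply: (@le_lt_trans _ _ (C' * (`|u0| + `|v0| + 1) * (e / 2 / M))).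
  by rewrite ler_wpM2l ?(ltW p3)// mulr_ge0// !addr_ge0.
by rewrite ltr_pM2r// /M ltrDl.
Unshelve. all: by end_near.
Qed.

End BilinearMaps.

Section ContinuousFunctionals.
Variables (K : numFieldType) (X : normedModType K).

Definition cfunctional_pred : {pred X -> K^o} :=
  fun f => `[< linear f /\ continuous f >].

(* The topological dual: continuous linear functionals (with the operator norm
   dual_norm below). *)
Record dual := Dual { dual_val :> X -> K^o ; _ : dual_val \in cfunctional_pred }.

HB.instance Definition _ := [isSub for dual_val].
HB.instance Definition _ := [Choice of dual by <:].

Lemma cfunctional_submod_closed : submod_closed cfunctional_pred.
Proof.
split=> [|c f g /asboolP[fl fc] /asboolP[gl gc]]; apply/asboolP; split.
- by move=> c x y /=; rewrite scaler0 addr0.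
- by move=> x; exact: cvg_cst.
- move=> d x y; rewrite !fctE fl gl !scalerDr !scalerA (mulrC c d) -!addrA.
  by congr (_ + _); rewrite addrCA.
- by move=> x; apply: cvgD; [apply: cvgZr; exact: fc|exact: gc].
Qed.

HB.instance Definition _ :=
  GRing.isSubmodClosed.Build K (X -> K^o) cfunctional_pred
    cfunctional_submod_closed.
HB.instance Definition _ := [SubChoice_isSubLmodule of dual by <:].

Lemma dualP (f g : dual) : (forall x, f x = g x) -> f = g.
Proof. by move=> fg; apply: val_inj; apply/funext. Qed.

Lemma dual_linear (f : dual) : linear f.
Proof. by case: f => f /= /asboolP[]. Qed.

Lemma dual_continuous (f : dual) : continuous f.
Proof. by case: f => f /= /asboolP[]. Qed.

HB.instance Definition _ (f : dual) :=
  GRing.isLinear.Build K X K^o *:%R f (dual_linear f).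

Lemma dualDE (f g : dual) x : (f + g) x = f x + g x. Proof. by []. Qed.
Lemma dualNE (f : dual) x : (- f) x = - f x. Proof. by []. Qed.
Lemma dualZE c (f : dual) x : (c *: f) x = c *: f x. Proof. by []. Qed.
Lemma dual0E x : (0 : dual) x = 0. Proof. by []. Qed.

Lemma dual_bounded (f : dual) :
  exists2 C : K, 0 <= C & forall x, `|f x| <= C * `|x|.
Proof.
have /linear_boundedP : bounded_near f (nbhs (0 : X)).
  by apply: continuous_linear_bounded; exact: dual_continuous.
by move=> /pinfty_ex_gt0 [C C0 fC]; exists C => //; exact: ltW.
Qed.

Lemma bounded_functional (f : X -> K^o) (C : K) : linear f ->
  (forall x, `|f x| <= C * `|x|) -> f \in cfunctional_pred.
Proof.
move=> fl fC; apply/asboolP; split => // x.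
apply/cvgrPdist_lt => /= e e0.
have [C' C'0 {}fC] : exists2 C', 0 < C' & forall u, `|f u| <= C' * `|u|.
  exists (`|C| + 1); first by rewrite ltr_wpDl.
  move=> u; have [->|u0] := eqVneq u 0.
    by have := fC 0; rewrite !normr0 !mulr0.
  apply: le_trans (fC u) _; rewrite ler_wpM2r//.
  have : 0 <= C by have := le_trans (normr_ge0 _) (fC u);
    rewrite pmulr_lge0// normr_gt0.
  by move=> C0; rewrite ger0_norm// lerDl.
near=> y.
have -> : f x - f y = f (x - y).
  by have := fl (-1) y x; rewrite !scaleN1r (addrC _ x) (addrC _ (f x)).
apply: le_lt_trans (fC _) _; rewrite -ltr_pdivlMl//.
by near: y; apply: cvgr_dist_lt; rewrite ?mulr_gt0 ?invr_gt0.
Unshelve. all: by end_near.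
Qed.

End ContinuousFunctionals.

Lemma cauchy_normP (K : numFieldType) (V : normedModType K) (F : set_system V) :
  ProperFilter F ->
  cauchy F <-> forall e : K, 0 < e -> exists x, F [set y | `|x - y| < e].
Proof.
move=> FF; rewrite cauchyP /cauchy_ex; split => h e e0.
  by have [x] := h e e0; rewrite -ball_normE; exists x.
by have [x xF] := h e e0; exists x; rewrite -ball_normE.
Qed.

Lemma cvg_normP (K : numFieldType) (V : normedModType K) (F : set_system V)
    (l : V) : ProperFilter F ->
  F --> l <-> forall e : K, 0 < e -> F [set y | `|l - y| < e].
Proof.
move=> FF; split => [/cvgrPdist_lt h e e0|h]; first exact: h.
exact/(@cvgrPdist_lt _ _ _ F _ id).
Qed.

Section ModuleBounds.
Variables (K : numFieldType) (A : banachAlgType K) (X : banachBimodType A).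

Lemma lact_bounded :
  exists2 C : K, 0 <= C & forall a (x : X), `|lact a x| <= C * (`|a| * `|x|).
Proof.
apply: bilinear_continuous_bounded.
- exact: lactZl.
- exact: lactZr.
- exact: lact_continuous.
Qed.

Lemma ract_bounded :
  exists2 C : K, 0 <= C & forall (x : X) a, `|ract x a| <= C * (`|x| * `|a|).
Proof.
apply: bilinear_continuous_bounded.
- exact: ractZl.
- exact: ractZr.
- exact: ract_continuous.
Qed.

End ModuleBounds.

Section Submodules.
Variables (K : numFieldType) (A : banachAlgType K) (X : banachBimodType A).

Record closedSubbimod := ClosedSubbimod {
  subbimod_set : set X ;
  subbimod_closed : closed subbimod_set ;
  subbimod0 : subbimod_set 0 ;
  subbimodD : forall x y,
    subbimod_set x -> subbimod_set y -> subbimod_set (x + y) ;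
  subbimodZ : forall (c : K) x, subbimod_set x -> subbimod_set (c *: x) ;
  subbimod_lact : forall a x, subbimod_set x -> subbimod_set (lact a x) ;
  subbimod_ract : forall x a, subbimod_set x -> subbimod_set (ract x a)
}.

Variable Y : closedSubbimod.

Definition subbimod_pred : {pred X} := fun x => `[< subbimod_set Y x >].

Lemma subbimod_submod_closed : submod_closed subbimod_pred.
Proof.
split; first by apply/asboolP; exact: subbimod0.
move=> c x y /asboolP Yx /asboolP Yy; apply/asboolP.
by apply: subbimodD => //; exact: subbimodZ.
Qed.

HB.instance Definition _ :=
  GRing.isSubmodClosed.Build K X subbimod_pred subbimod_submod_closed.

(* The submodule Y as a type, with the norm of X. *)
Record submod := Submod { submod_val :> X ; _ : submod_val \in subbimod_pred }.

HB.instance Definition _ := [isSub for submod_val].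
HB.instance Definition _ := [Choice of submod by <:].
HB.instance Definition _ := [SubChoice_isSubLmodule of submod by <:].

Lemma submodP (y : submod) : subbimod_set Y y.
Proof. by case: y => y /= /asboolP. Qed.

Lemma submod_norm0_eq0 (y : submod) : `|y : X| = 0 -> y = 0.
Proof. by move=> /normr0_eq0 y0; exact: val_inj. Qed.

HB.instance Definition _ := Lmodule_isNormed.Build K submod
  (norm := fun y => `|submod_val y|)
  (fun x y => ler_normD (x : X) (y : X)) (fun c x => normrZ c (x : X))
  submod_norm0_eq0.

Lemma submod_normE (y : submod) : `|y| = `|y : X|. Proof. by []. Qed.

Lemma submod_complete (F : set_system submod) :
  ProperFilter F -> cauchy F -> cvg F.
Proof.
move=> FF /cauchy_normP Fc.
have /cauchy_cvg/cvg_ex [x] : cauchy (submod_val @ F).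
  by apply/cauchy_normP => e /Fc [y Fy]; exists (y : X).
move=> /cvg_normP Fx.
have xY : x \in subbimod_pred.
  apply/asboolP; apply: subbimod_closed => B /nbhs_normP [e /= e0 eB].
  have /filter_ex [y /= yx] : F [set y : submod | `|x - submod_val y| < e] by exact: Fx.
  by exists (y : X); split; [exact: submodP|exact: eB].
apply/cvg_ex; exists (Submod xY); apply/cvg_normP => e e0; exact: Fx.
Qed.

HB.instance Definition _ := Uniform_isComplete.Build submod submod_complete.

Definition submod_lact (a : A) (y : submod) : submod :=
  Submod (asboolT (subbimod_lact a (submodP y))).

Definition submod_ract (y : submod) (a : A) : submod :=
  Submod (asboolT (subbimod_ract a (submodP y))).


Let slactDl a b x : submod_lact (a + b) x = submod_lact a x + submod_lact b x.
Proof. by apply: val_inj; exact: lactDl. Qed.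
Let slactDr a x y : submod_lact a (x + y) = submod_lact a x + submod_lact a y.
Proof. by apply: val_inj; exact: lactDr. Qed.
Let slactZl (c : K) a x : submod_lact (c *: a) x = c *: submod_lact a x.
Proof. by apply: val_inj; exact: lactZl. Qed.
Let slactZr (c : K) a x : submod_lact a (c *: x) = c *: submod_lact a x.
Proof. by apply: val_inj; exact: lactZr. Qed.
Let sractDl x y a : submod_ract (x + y) a = submod_ract x a + submod_ract y a.
Proof. by apply: val_inj; exact: ractDl. Qed.
Let sractDr x a b : submod_ract x (a + b) = submod_ract x a + submod_ract x b.
Proof. by apply: val_inj; exact: ractDr. Qed.
Let sractZl (c : K) x a : submod_ract (c *: x) a = c *: submod_ract x a.
Proof. by apply: val_inj; exact: ractZl. Qed.
Let sractZr (c : K) x a : submod_ract x (c *: a) = c *: submod_ract x a.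
Proof. by apply: val_inj; exact: ractZr. Qed.
Let slactA a b x : submod_lact (amul a b) x = submod_lact a (submod_lact b x).
Proof. by apply: val_inj; exact: lactA. Qed.
Let sractA x a b : submod_ract x (amul a b) = submod_ract (submod_ract x a) b.
Proof. by apply: val_inj; exact: ractA. Qed.
Let slractA a x b :
  submod_ract (submod_lact a x) b = submod_lact a (submod_ract x b).
Proof. by apply: val_inj; exact: lractA. Qed.

Let slact_continuous :
  continuous (fun p : A * submod => submod_lact p.1 p.2).
Proof.
have [C _ lC] := lact_bounded X.
apply: (bilinear_bounded_continuous slactDl slactDr slactZl slactZr (C := C)).
by move=> a x; exact: lC.
Qed.

Let sract_continuous :
  continuous (fun p : submod * A => submod_ract p.1 p.2).
Proof.
have [C _ rC] := ract_bounded X.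
apply: (bilinear_bounded_continuous sractDl sractDr sractZl sractZr (C := C)).
by move=> x a; exact: rC.
Qed.

HB.instance Definition _ := CompleteNormedModule_isBanachBimodule.Build K A
  submod slactDl slactDr slactZl slactZr sractDl sractDr sractZl sractZr
  slactA sractA slractA slact_continuous sract_continuous.

End Submodules.

Section QuotientModule.
Variables (K : numFieldType) (A : banachAlgType K) (X : banachBimodType A).
Variable Y : closedSubbimod X.

(* The quotient X/Y. *)
Definition quomod := Quotient.quot (subbimod_pred Y).
HB.instance Definition _ := GRing.Zmodule.on quomod.

Definition quo_pi (x : X) : quomod :=
  (\pi_(Quotient.quot (subbimod_pred Y)) x)%qT.
Definition quo_repr (q : quomod) : X := repr q.

Lemma quo_reprK q : quo_pi (quo_repr q) = q.
Proof. exact: reprK. Qed.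

Lemma quo_piP x y : quo_pi x = quo_pi y <-> subbimod_set Y (x - y).
Proof.
split=> [/eqP|Yxy].
  by rewrite -Quotient.idealrBE => /asboolP.
by apply/eqP; rewrite -Quotient.idealrBE; exact/asboolP.
Qed.

Lemma quo_piD x y : quo_pi (x + y) = quo_pi x + quo_pi y.
Proof. exact: raddfD. Qed.

Lemma quo_piB x y : quo_pi (x - y) = quo_pi x - quo_pi y.
Proof. exact: raddfB. Qed.

Lemma quo_pi0 : quo_pi 0 = 0.
Proof. exact: raddf0. Qed.

Definition quo_scale (c : K) (q : quomod) : quomod := quo_pi (c *: quo_repr q).

Lemma quo_scaleE c x : quo_scale c (quo_pi x) = quo_pi (c *: x).
Proof.
apply/quo_piP; rewrite -scalerBr; apply: subbimodZ; apply/quo_piP.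
exact: quo_reprK.
Qed.

Let quo_scalerA a b q : quo_scale a (quo_scale b q) = quo_scale (a * b) q.
Proof. by rewrite -(quo_reprK q) !quo_scaleE scalerA. Qed.
Let quo_scale1r : left_id 1 quo_scale.
Proof. by move=> q; rewrite -(quo_reprK q) !quo_scaleE scale1r. Qed.
Let quo_scalerDr : right_distributive quo_scale +%R.
Proof.
move=> c p q; rewrite -(quo_reprK p) -(quo_reprK q) -quo_piD !quo_scaleE.
by rewrite scalerDr quo_piD.
Qed.
Let quo_scalerDl q : {morph quo_scale^~ q : a b / a + b}.
Proof.
by move=> a b; rewrite -(quo_reprK q) !quo_scaleE scalerDl quo_piD.
Qed.

HB.instance Definition _ := GRing.Zmodule_isLmodule.Build K quomod
  quo_scalerA quo_scale1r quo_scalerDr quo_scalerDl.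

Lemma quo_piZ c x : quo_pi (c *: x) = c *: quo_pi x.
Proof. by rewrite -quo_scaleE. Qed.

(* Only used over scalars R k, where the infimum exists (quo_norm_inf). *)
Definition quo_norm (q : quomod) : K :=
  infimum 0 [set `|x| | x in [set x : X | quo_pi x = q]].

Definition quo_lact (a : A) (q : quomod) : quomod :=
  quo_pi (lact a (quo_repr q)).

Definition quo_ract (q : quomod) (a : A) : quomod :=
  quo_pi (ract (quo_repr q) a).

Lemma lactB (a : A) (x y : X) : lact a (x - y) = lact a x - lact a y.
Proof. by rewrite lactDr -scaleN1r lactZr scaleN1r. Qed.

Lemma ractB (x y : X) (a : A) : ract (x - y) a = ract x a - ract y a.
Proof. by rewrite ractDl -scaleN1r ractZl scaleN1r. Qed.

Lemma quo_lactE a x : quo_lact a (quo_pi x) = quo_pi (lact a x).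
Proof.
apply/quo_piP; rewrite -lactB; apply: subbimod_lact; apply/quo_piP.
exact: quo_reprK.
Qed.

Lemma quo_ractE a x : quo_ract (quo_pi x) a = quo_pi (ract x a).
Proof.
apply/quo_piP; rewrite -ractB; apply: subbimod_ract; apply/quo_piP.
exact: quo_reprK.
Qed.

End QuotientModule.

Section QuotientNorm.
Variables (R : realType) (k : scalar_kind).
Local Notation K := (scalars R k).
Variables (A : banachAlgType K) (X : banachBimodType A).
Variable Y : closedSubbimod X.
Local Notation pi := (@quo_pi K A X Y).
Local Notation Q := (quomod Y).

Lemma quo_norm_inf (q : Q) :
  infimums [set `|x| | x in [set x : X | pi x = q]] (quo_norm q).
Proof.
rewrite /quo_norm /infimum; case: ifPn => [/eqP e0|_].
  have : [set `|x| | x in [set x : X | pi x = q]] `|quo_repr q|.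
    by exists (quo_repr q) => //; exact: quo_reprK.
  by rewrite e0.
have [|_ [x _ <-]|m hm] //= := @scalars_inf R k [set `|x| | x in [set x : X | pi x = q]].
  by exists `|quo_repr q|; exists (quo_repr q) => //; exact: quo_reprK.
exact: (xgetPex 0 (ex_intro _ m hm)).
Qed.

Lemma quo_norm_le x : quo_norm (pi x) <= `|x|.
Proof. by have [h _] := quo_norm_inf (pi x); apply: h; exists x. Qed.

Lemma quo_norm_ge (q : Q) m : (forall x, pi x = q -> m <= `|x|) ->
  m <= quo_norm q.
Proof.
by move=> h; have [_ h'] := quo_norm_inf q; apply: h' => _ [x /h xm <-].
Qed.

Lemma quo_norm_ge0 (q : Q) : 0 <= quo_norm q.
Proof. exact: quo_norm_ge. Qed.

Lemma quo_norm_lift (q : Q) e : quo_norm q < e ->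
  exists2 x, pi x = q & `|x| < e.
Proof.
move=> qe; apply: contrapT => /forall2NP h.
have er : e \is Num.real.
  by rewrite ger0_real// (le_trans (quo_norm_ge0 q))// ltW.
suff /(lt_le_trans qe) : e <= quo_norm q by rewrite ltxx.
apply: quo_norm_ge => x xq; rewrite real_leNgt ?normr_real//.
by have [|/negP] := h x.
Qed.

Let quo_ler_normD (p q : Q) : quo_norm (p + q) <= quo_norm p + quo_norm q.
Proof.
rewrite -lerBlDr; apply: quo_norm_ge => x <-.
rewrite lerBlDr -lerBlDl; apply: quo_norm_ge => y <-.
rewrite lerBlDl; apply: le_trans (ler_normD _ _).
by rewrite -quo_piD; exact: quo_norm_le.
Qed.

Let quo_normrZ (c : K) (q : Q) : quo_norm (c *: q) = `|c| * quo_norm q.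
Proof.
have le1 (d : K) (p : Q) : quo_norm (d *: p) <= `|d| * quo_norm p.
  have [->|d0] := eqVneq d 0.
    rewrite normr0 mul0r scale0r -(@quo_pi0 _ _ _ Y).
    by apply: le_trans (quo_norm_le _) _; rewrite normr0.
  rewrite -ler_pdivrMl ?normr_gt0//; apply: quo_norm_ge => x <-.
  rewrite ler_pdivrMl ?normr_gt0// -normrZ -quo_piZ.
  exact: quo_norm_le.
apply/eqP; rewrite eq_le le1 /=.
have [->|c0] := eqVneq c 0; first by rewrite normr0 mul0r quo_norm_ge0.
rewrite -ler_pdivlMl ?normr_gt0// -normfV.
by apply: le_trans (le1 _ _); rewrite scalerA mulVf// scale1r.
Qed.

Let quo_normr0_eq0 (q : Q) : quo_norm q = 0 -> q = 0.
Proof.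
move=> q0; rewrite -(quo_reprK q) -(@quo_pi0 _ _ _ Y).
apply/quo_piP; rewrite subr0; apply: subbimod_closed => B.
move=> /nbhs_normP [e /= e0 eB].
have [x xq xe] : exists2 x, pi x = q & `|x| < e.
  by apply: quo_norm_lift; rewrite q0.
exists (quo_repr q - x); split; first by apply/quo_piP; rewrite quo_reprK.
by apply: eB; rewrite /ball_/= subKr.
Qed.

HB.instance Definition _ := Lmodule_isNormed.Build K (quomod Y)
  quo_ler_normD quo_normrZ quo_normr0_eq0.

Lemma quo_normE (q : Q) : `|q| = quo_norm q. Proof. by []. Qed.

End QuotientNorm.

Section QuotientBimodule.
Variables (R : realType) (k : scalar_kind).
Local Notation K := (scalars R k).
Variables (A : banachAlgType K) (X : banachBimodType A).
Variable Y : closedSubbimod X.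
Local Notation pi := (@quo_pi K A X Y).
Local Notation Q := (quomod Y).

Lemma half_pow_small (e : K) : 0 < e -> exists n, 2^-1 ^+ n < e.
Proof.
move=> e0; apply: contrapT => /forallNP h.
have p0 n : 0 < (2^-1 : K) ^+ n by rewrite exprn_gt0 ?invr_gt0 ?ltr0n.
have [|_ [n _ <-]|m [m1 m2]] := @scalars_inf R k (range (fun n => 2^-1 ^+ n)).
- by exists (2^-1 ^+ 0), 0%N.
- exact: ltW.
have em : e <= m.
  apply: m2 => _ [n _ <-]; rewrite real_leNgt ?gtr0_real//.
  exact/negP.
have : m + m <= m.
  apply: m2 => _ [n _ <-].
  have -> : (2^-1 : K) ^+ n = 2^-1 ^+ n.+1 + 2^-1 ^+ n.+1.
    by rewrite exprS (mulrC 2^-1) -splitr.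
  by apply: lerD; apply: m1; exists n.+1.
rewrite gerDl => m0; have := lt_le_trans e0 (le_trans em m0).
by rewrite ltxx.
Qed.

Lemma quo_complete (F : set_system Q) : ProperFilter F -> cauchy F -> cvg F.
Proof.
move=> FF /cauchy_normP Fc.
pose h n : K := 2^-1 ^+ n.
have h0 n : 0 < h n by rewrite exprn_gt0 ?invr_gt0 ?ltr0n.
have hS n : h n = h n.+1 + h n.+1.
  by rewrite /h exprS (mulrC 2^-1) -splitr.
have [p Fp] : {p : nat -> Q & forall n, F [set q | `|p n - q| < h n]}.
  apply: (@choice _ _ (fun n p => F [set q | `|p - q| < h n])) => n.
  exact: Fc.
have pS n : `|p n.+1 - p n| < h n + h n.
  have [q [/= q1 q2]] := filter_ex (filterI (Fp n.+1) (Fp n)).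
  rewrite -(subrKA q) (le_lt_trans (ler_normD _ _))// (distrC q).
  apply: ltrD => //; apply: lt_trans q1 _.
  by rewrite (hS n) ltrDl.
have [d /all_and2[dp dn]] : {d : nat -> X &
    forall n, pi (d n) = p n.+1 - p n /\ `|d n| < h n + h n}.
  apply: (@choice _ _ (fun n x => pi x = p n.+1 - p n /\ `|x| < h n + h n)) => n.
  have [x x1 x2] := quo_norm_lift (pS n).
  by exists x.
pose s n := \sum_(i < n) d i.
pose x0 := quo_repr (p 0%N).
have pis n : pi (x0 + s n) = p n.
  elim: n => [|n IH]; first by rewrite /s big_ord0 addr0 quo_reprK.
  by rewrite /s big_ord_recr /= addrA quo_piD IH dp addrC subrK.
have sd n j : `|s (n + j)%N - s n| <= h n *+ 4 - h (n + j)%N *+ 4.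
  elim: j => [|j IH]; first by rewrite addn0 !subrr normr0.
  rewrite addnS -(subrKA (s (n + j)%N)) addrC.
  apply: le_trans (ler_normD _ _) _.
  have -> : s (n + j).+1 - s (n + j)%N = d (n + j)%N.
    by rewrite /s big_ord_recr /= addrAC subrr add0r.
  apply: le_trans (lerD IH (ltW (dn _))) _.
  rewrite -addrA lerD2l (hS (n + j)%N).
  rewrite [X in X <= _](_ : _ = - (h (n + j).+1 *+ 4)) //.
  by rewrite mulrnDl opprD -!mulr2n -mulrnA subrK.
have sn n m : (n <= m)%N -> `|s n - s m| < h n *+ 4.
  move=> nm; rewrite distrC -(subnKC nm).
  by apply: le_lt_trans (sd _ _) _; rewrite gtrBl pmulrn_lgt0.
have /cauchy_cvg/cvg_ex [l /cvg_normP sl] : cauchy (s @ \oo).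
  apply/cauchy_normP => e e0.
  have [|n ne] := @half_pow_small (e / 4); first by rewrite divr_gt0.
  exists (s n); exists n => // m /= nm.
  apply: lt_trans (sn _ _ nm) _.
  by rewrite -mulr_natr -ltr_pdivlMr.
apply/cvg_ex; exists (pi (x0 + l)); apply/cvg_normP => e e0.
have e2 : 0 < e / 2 by rewrite divr_gt0.
have [n ne] := half_pow_small e2.
have [m [mn me]] : exists m, (n <= m)%N /\ `|l - s m| < e / 2.
  have [N _ hN] := sl _ e2; exists (maxn n N); split; first exact: leq_maxl.
  by apply: hN; exact: leq_maxr.
have hm : h m <= h n.
  rewrite -(subnKC mn); elim: (m - n)%N => [|j IH]; first by rewrite addn0.
  by rewrite addnS; apply: le_trans IH; rewrite (hS (n + j)%N) lerDl ltW.
apply: filterS (Fp m) => q /= qm.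
rewrite [e]splitr -(subrKA (p m)); apply: le_lt_trans (ler_normD _ _) _.
apply: ltrD; last by apply: lt_trans qm _; exact: le_lt_trans hm ne.
rewrite -(pis m) -quo_piB; apply: le_lt_trans (quo_norm_le _ _) _.
by rewrite opprD addrACA subrr add0r.
Qed.

HB.instance Definition _ := Uniform_isComplete.Build (quomod Y) quo_complete.

Let qlactDl a b (q : Q) : quo_lact (a + b) q = quo_lact a q + quo_lact b q.
Proof. by rewrite -(quo_reprK q) !quo_lactE lactDl quo_piD. Qed.
Let qlactDr a (p q : Q) : quo_lact a (p + q) = quo_lact a p + quo_lact a q.
Proof.
rewrite -(quo_reprK p) -(quo_reprK q) -quo_piD !quo_lactE.
by rewrite lactDr quo_piD.
Qed.
Let qlactZl (c : K) a (q : Q) : quo_lact (c *: a) q = c *: quo_lact a q.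
Proof. by rewrite -(quo_reprK q) !quo_lactE lactZl quo_piZ. Qed.
Let qlactZr (c : K) a (q : Q) : quo_lact a (c *: q) = c *: quo_lact a q.
Proof. by rewrite -(quo_reprK q) -quo_piZ !quo_lactE lactZr quo_piZ. Qed.
Let qractDl (p q : Q) a : quo_ract (p + q) a = quo_ract p a + quo_ract q a.
Proof.
rewrite -(quo_reprK p) -(quo_reprK q) -quo_piD !quo_ractE.
by rewrite ractDl quo_piD.
Qed.
Let qractDr (q : Q) a b : quo_ract q (a + b) = quo_ract q a + quo_ract q b.
Proof. by rewrite -(quo_reprK q) !quo_ractE ractDr quo_piD. Qed.
Let qractZl (c : K) (q : Q) a : quo_ract (c *: q) a = c *: quo_ract q a.
Proof. by rewrite -(quo_reprK q) -quo_piZ !quo_ractE ractZl quo_piZ. Qed.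
Let qractZr (c : K) (q : Q) a : quo_ract q (c *: a) = c *: quo_ract q a.
Proof. by rewrite -(quo_reprK q) !quo_ractE ractZr quo_piZ. Qed.
Let qlactA a b (q : Q) : quo_lact (amul a b) q = quo_lact a (quo_lact b q).
Proof. by rewrite -(quo_reprK q) !quo_lactE lactA. Qed.
Let qractA (q : Q) a b : quo_ract q (amul a b) = quo_ract (quo_ract q a) b.
Proof. by rewrite -(quo_reprK q) !quo_ractE ractA. Qed.
Let qlractA a (q : Q) b : quo_ract (quo_lact a q) b = quo_lact a (quo_ract q b).
Proof.
by rewrite -(quo_reprK q) quo_lactE !quo_ractE quo_lactE lractA.
Qed.

Let quo_bound (T : X -> X) (M : K) (q : Q) : 0 <= M ->
  (forall x, `|T x| <= M * `|x|) -> (forall x, pi x = q -> pi (T x) = pi (T (quo_repr q))) ->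
  `|pi (T (quo_repr q))| <= M * `|q|.
Proof.
move=> M0 TM Tq.
have Tle x : pi x = q -> `|pi (T (quo_repr q))| <= M * `|x|.
  by move=> /Tq <-; apply: le_trans (quo_norm_le _ _) (TM x).
have [M00|Mn0] := eqVneq M 0.
  by have := Tle _ (quo_reprK q); rewrite M00 !mul0r.
have Mp : 0 < M by rewrite lt_def Mn0.
rewrite -ler_pdivrMl//; apply: quo_norm_ge => x xq.
by rewrite ler_pdivrMl//; exact: Tle.
Qed.

Let qlact_continuous : continuous (fun p : A * Q => quo_lact p.1 p.2).
Proof.
have [C C0 lC] := lact_bounded X.
apply: (bilinear_bounded_continuous qlactDl qlactDr qlactZl qlactZr (C := C)).
move=> a q; rewrite mulrA; apply: quo_bound => [||x <-].
- by rewrite mulr_ge0.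
- by move=> x; rewrite -mulrA; exact: lC.
- by rewrite -!quo_lactE quo_reprK.
Qed.

Let qract_continuous : continuous (fun p : Q * A => quo_ract p.1 p.2).
Proof.
have [C C0 rC] := ract_bounded X.
apply: (bilinear_bounded_continuous qractDl qractDr qractZl qractZr (C := C)).
move=> q a; rewrite (mulrC `|q|) mulrA.
apply: (@quo_bound (fun x => ract x a)) => [||x <-].
- by rewrite mulr_ge0.
- by move=> x; rewrite -mulrA (mulrC `|a|); exact: rC.
- by rewrite -!quo_ractE quo_reprK.
Qed.

HB.instance Definition _ := CompleteNormedModule_isBanachBimodule.Build K A
  (quomod Y) qlactDl qlactDr qlactZl qlactZr qractDl qractDr qractZl qractZr
  qlactA qractA qlractA qlact_continuous qract_continuous.

End QuotientBimodule.

Lemma complex_norm_lt (R : realType) (z : R[i]) (e : R) :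
  `|z| < e%:C%C -> `|complex.Re z| < e /\ `|complex.Im z| < e.
Proof.
rewrite normc_def ltcR => ze; split; apply: le_lt_trans ze.
  by rewrite -sqrtr_sqr ler_wsqrtr// lerDl sqr_ge0.
by rewrite -sqrtr_sqr ler_wsqrtr// lerDr sqr_ge0.
Qed.

Lemma complex_norm_le (R : realType) (z : R[i]) :
  `|z| <= (`|complex.Re z| + `|complex.Im z|)%:C%C.
Proof.
rewrite normc_def lecR -[leRHS]ger0_norm ?addr_ge0// -sqrtr_sqr ler_wsqrtr//.
rewrite sqrrD !real_normK ?num_real// -addrA lerD2l.
by rewrite lerDr mulrn_wge0// mulr_ge0.
Qed.

Lemma scalars_complete (R : realType) (k : scalar_kind)
    (F : set_system (scalars R k)^o) : ProperFilter F -> cauchy F -> cvg F.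
Proof.
case: k F => F FF; first exact: (@cauchy_cvg R^o F).
move=> /cauchy_normP Fc.
have part (p : R[i] -> R) : (forall z w, p (z - w) = p z - p w) ->
    (forall z e, `|z| < e%:C%C -> `|p z| < e) ->
    exists l : R, forall e, 0 < e -> F [set z | `|l - p z| < e].
  move=> pB pn.
  have /cauchy_cvg/cvg_ex [l pl] : cauchy ((p : R[i] -> R^o) @ F).
    apply/cauchy_normP => e e0.
    have [|x Fx] := Fc e%:C%C; first by rewrite ltcR.
    exists (p x); rewrite /nbhs /=; apply: filterS Fx => y /= /pn.
    by rewrite pB.
  exists l => e e0; move/(@cvg_normP _ R^o) : pl => /(_ e e0).
  by [].
have [||a Fa] := part (@complex.Re R).
- by case=> [? ?] [? ?].
- by move=> z e /complex_norm_lt[].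
have [||b Fb] := part (@complex.Im R).
- by case=> [? ?] [? ?].
- by move=> z e /complex_norm_lt[].
apply/cvg_ex; exists (a +i* b)%C; apply/cvg_normP => e e0.
have [r r0 er] : exists2 r : R, 0 < r & e = r%:C%C.
  by case: e e0 => x y; rewrite ltcE /= => /andP[/eqP -> x0]; exists x.
have r2 : 0 < r / 2 by rewrite divr_gt0.
apply: filterS (filterI (Fa _ r2) (Fb _ r2)) => z /= [za zb].
rewrite er; apply: le_lt_trans (complex_norm_le _) _.
rewrite ltcR [ltRHS]splitr.
by case: z za zb => u v /= za zb; apply: ltrD.
Qed.

Section DualBimodule.
Variables (R : realType) (k : scalar_kind).
Local Notation K := (scalars R k).

Section DualNorm.
Variable X : normedModType K.

Definition dual_norm (f : dual X) : K :=
  supremum 0 [set `|f x| | x in [set x : X | `|x| <= 1]].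

Lemma dual_norm_sup (f : dual X) :
  supremums [set `|f x| | x in [set x : X | `|x| <= 1]] (dual_norm f).
Proof.
rewrite /dual_norm /supremum; case: ifPn => [/eqP e0|_].
  have : [set `|f x| | x in [set x : X | `|x| <= 1]] `|f 0|.
    by exists 0 => //=; rewrite normr0.
  by rewrite e0.
have [|||m hm] := @scalars_sup R k [set `|f x| | x in [set x : X | `|x| <= 1]].
- by exists `|f 0|, 0 => //=; rewrite normr0.
- by move=> _ [x _ <-].
- have [C C0 fC] := dual_bounded f.
  exists C => _ [x x1 <-]; apply: le_trans (fC x) _.
  by rewrite ler_piMr.
exact: (xgetPex 0 (ex_intro _ m hm)).
Qed.

Lemma dual_norm_ge0 (f : dual X) : 0 <= dual_norm f.
Proof.
have [h _] := dual_norm_sup f; apply: le_trans (normr_ge0 (f 0)) _.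
by apply: h; exists 0 => //=; rewrite normr0.
Qed.

Lemma le_dual_norm (f : dual X) x : `|f x| <= dual_norm f * `|x|.
Proof.
have [->|x0] := eqVneq x 0; first by rewrite linear0 !normr0 mulr0.
have nx : 0 < `|x| by rewrite normr_gt0.
have [h _] := dual_norm_sup f.
rewrite -ler_pdivrMr// mulrC.
have -> : `|x|^-1 * `|f x| = `|f (`|x|^-1 *: x)|.
  by rewrite linearZ /= (normrZ _ (f x : K^o)) normfV normr_id.
by apply: h; exists (`|x|^-1 *: x) => //=; rewrite normrZ normfV normr_id mulVf ?gt_eqF.
Qed.

Lemma dual_norm_le (f : dual X) (M : K) : 0 <= M ->
  (forall x, `|f x| <= M * `|x|) -> dual_norm f <= M.
Proof.
move=> M0 fM; have [_ h] := dual_norm_sup f; apply: h => _ [x x1 <-].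
by apply: le_trans (fM x) _; rewrite ler_piMr.
Qed.

Let dual_ler_normD (f g : dual X) :
  dual_norm (f + g) <= dual_norm f + dual_norm g.
Proof.
apply: dual_norm_le => [|x]; first by rewrite addr_ge0 ?dual_norm_ge0.
rewrite dualDE; apply: le_trans (ler_normD _ _) _.
by rewrite mulrDl lerD ?le_dual_norm.
Qed.

Let dual_normrZ (c : K) (f : dual X) : dual_norm (c *: f) = `|c| * dual_norm f.
Proof.
have le1 (d : K) (g : dual X) : dual_norm (d *: g) <= `|d| * dual_norm g.
  apply: dual_norm_le => [|x]; first by rewrite mulr_ge0 ?dual_norm_ge0.
  by rewrite dualZE (normrZ _ (g x : K^o)) -mulrA ler_wpM2l ?le_dual_norm.
apply/eqP; rewrite eq_le le1 /=.
have [->|c0] := eqVneq c 0; first by rewrite normr0 mul0r dual_norm_ge0.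
rewrite -ler_pdivlMl ?normr_gt0// -normfV.
by apply: le_trans (le1 _ _); rewrite scalerA mulVf// scale1r.
Qed.

Let dual_normr0_eq0 (f : dual X) : dual_norm f = 0 -> f = 0.
Proof.
move=> f0; apply: dualP => x; have := le_dual_norm f x.
by rewrite f0 mul0r normr_le0 => /eqP.
Qed.

HB.instance Definition _ := Lmodule_isNormed.Build K (dual X)
  dual_ler_normD dual_normrZ dual_normr0_eq0.

Lemma dual_normE (f : dual X) : `|f| = dual_norm f. Proof. by []. Qed.

Lemma dual_complete (F : set_system (dual X)) :
  ProperFilter F -> cauchy F -> cvg F.
Proof.
move=> FF /cauchy_normP Fc.
have Fx x : exists l : K^o, forall e, 0 < e -> F [set f | `|l - f x| < e].
  have /scalars_complete/cvg_ex [l fl] :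
      cauchy ((fun f : dual X => f x : K^o) @ F).
    apply/cauchy_normP => e e0.
    have x1 : 0 < `|x| + 1 by rewrite ltr_wpDl.
    have [|f0 Ff] := Fc (e / (`|x| + 1)); first by rewrite divr_gt0.
    exists (f0 x); rewrite /nbhs /=; apply: filterS Ff => f /= ff.
    rewrite -dualNE -dualDE; apply: le_lt_trans (le_dual_norm _ _) _.
    apply: (@le_lt_trans _ _ (dual_norm (f0 - f) * (`|x| + 1))).
      by rewrite ler_wpM2l ?dual_norm_ge0// lerDl.
    by rewrite -ltr_pdivlMr.
  by exists l => e e0; move/(@cvg_normP _ K^o) : fl => /(_ e e0).
have [g Fg] : {g : X -> K^o &
    forall x e, 0 < e -> F [set f : dual X | `|g x - f x| < e]}.
  exact: (@choice _ _ (fun x l => forall e, 0 < e ->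
    F [set f : dual X | `|l - f x| < e])).
have small (z : K^o) : (forall e : K, 0 < e -> `|z| < e) -> z = 0.
  move=> h; apply: contrapT => /eqP; rewrite -normr_gt0 => /h.
  by rewrite ltxx.
have gl : linear g.
  move=> c x y; apply/eqP; rewrite -subr_eq0; apply/eqP; apply: small => e e0.
  have c1 : 0 < `|c| + 1 by rewrite ltr_wpDl.
  have e3 : 0 < e / 3 by rewrite divr_gt0 ?ltr0n.
  have e3c : 0 < e / 3 / (`|c| + 1) by rewrite divr_gt0.
  have [f [/= fxy [fx fy]]] := filter_ex (filterI (Fg (c *: x + y) _ e3)
    (filterI (Fg x _ e3c) (Fg y _ e3))).
  have -> : g (c *: x + y) - (c *: g x + g y) = (g (c *: x + y) - f (c *: x + y))
      - c *: (g x - f x) - (g y - f y).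
    rewrite dual_linear scalerBr -!addrA; congr (_ + _).
    by rewrite -!opprD addrACA !subrKC.
  have -> : e = e / 3 + e / 3 + e / 3.
    by rewrite -!mulrDl -mulr2n -mulrSr -[e *+ 3]mulr_natr mulfK ?pnatr_eq0.
  apply: le_lt_trans (ler_normB _ _) _; apply: ltrD => //.
  apply: le_lt_trans (ler_normB _ _) _; apply: ltrD => //.
  rewrite (normrZ c (g x - f x : K^o)).
  apply: (@le_lt_trans _ _ ((`|c| + 1) * `|g x - f x|)).
    by rewrite ler_wpM2r// lerDl.
  by rewrite -ltr_pdivlMl// mulrC.
have close e : 0 < e -> exists f0, F [set f | `|f0 - f| < e] /\
    forall f, `|f0 - f| < e -> forall x, `|g x - f x| <= (e + e) * `|x|.
  move=> e0; have [f0 Ff] := Fc e e0; exists f0; split => // f ff x.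
  rewrite real_leNgt ?normr_real ?realM ?realD ?normr_real ?gtr0_real//.
  apply/negP; rewrite -subr_gt0 => /(Fg x) Fgx.
  have [f1 [/= h1 h2]] := filter_ex (filterI Fgx Ff).
  have : `|g x - f x| < `|g x - f x|.
    rewrite -{1}(subrKA (f1 x)); apply: le_lt_trans (ler_normD _ _) _.
    rewrite -ltrBrDr; apply: lt_le_trans h1 _; rewrite lerD2l lerN2.
    rewrite -dualNE -dualDE; apply: le_trans (le_dual_norm _ _) _.
    rewrite ler_wpM2r// -dual_normE -(subrKA f0).
    apply: le_trans (ler_normD _ _) _.
    by apply: lerD; apply: ltW => //; rewrite distrC.
  by rewrite ltxx.
have gP : g \in cfunctional_pred (X := X).
  have [f0 [_ /(_ f0)]] := close 1 ltr01; rewrite subrr normr0 => /(_ ltr01) h.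
  have [C C0 fC] := dual_bounded f0.
  apply: (@bounded_functional _ _ _ (1 + 1 + C)) => // x.
  rewrite -(subrK (f0 x) (g x)) mulrDl; apply: le_trans (ler_normD _ _) _.
  by apply: lerD.
apply/cvg_ex; exists (Dual gP); apply/cvg_normP => e e0.
have e4 : 0 < e / 2 / 2 by rewrite !divr_gt0.
have [f0 [Ff h]] := close _ e4.
apply: filterS Ff => f /= /h {}h.
apply: (@le_lt_trans _ _ (e / 2)); last by rewrite [ltRHS]splitr ltrDl divr_gt0.
by rewrite dual_normE [e / 2]splitr; apply: dual_norm_le => //; rewrite ltW// addr_gt0.
Qed.

HB.instance Definition _ := Uniform_isComplete.Build (dual X) dual_complete.

End DualNorm.

Variables (A : banachAlgType K) (X : banachBimodType A).
Local Notation X' := (dual X).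

Lemma dual_lact_subproof (a : A) (f : X') :
  (fun x => f (ract x a)) \in cfunctional_pred (X := X).
Proof.
have [C C0 rC] := ract_bounded X.
apply: (@bounded_functional _ _ _ (dual_norm f * (C * `|a|))).
  by move=> c x y; rewrite ractDl ractZl linearP.
move=> x; apply: le_trans (le_dual_norm _ _) _.
rewrite -mulrA ler_wpM2l ?dual_norm_ge0//.
by rewrite -mulrA (mulrC `|a|).
Qed.

Lemma dual_ract_subproof (f : X') (a : A) :
  (fun x => f (lact a x)) \in cfunctional_pred (X := X).
Proof.
have [C C0 lC] := lact_bounded X.
apply: (@bounded_functional _ _ _ (dual_norm f * (C * `|a|))).
  by move=> c x y; rewrite lactDr lactZr linearP.
move=> x; apply: le_trans (le_dual_norm _ _) _.
by rewrite -mulrA ler_wpM2l ?dual_norm_ge0// -mulrA.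
Qed.

(* <x, a . f> = <x . a, f> and <x, f . a> = <a . x, f>. *)
Definition dual_lact (a : A) (f : X') : X' := Dual (dual_lact_subproof a f).
Definition dual_ract (f : X') (a : A) : X' := Dual (dual_ract_subproof f a).

Let dlactDl a b f : dual_lact (a + b) f = dual_lact a f + dual_lact b f.
Proof. by apply: dualP => x; rewrite dualDE /= ractDr linearD. Qed.
Let dlactDr a f g : dual_lact a (f + g) = dual_lact a f + dual_lact a g.
Proof. exact: dualP. Qed.
Let dlactZl (c : K) a f : dual_lact (c *: a) f = c *: dual_lact a f.
Proof. by apply: dualP => x; rewrite dualZE /= ractZr linearZ. Qed.
Let dlactZr (c : K) a f : dual_lact a (c *: f) = c *: dual_lact a f.
Proof. exact: dualP. Qed.
Let dractDl f g a : dual_ract (f + g) a = dual_ract f a + dual_ract g a.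
Proof. exact: dualP. Qed.
Let dractDr f a b : dual_ract f (a + b) = dual_ract f a + dual_ract f b.
Proof. by apply: dualP => x; rewrite dualDE /= lactDl linearD. Qed.
Let dractZl (c : K) f a : dual_ract (c *: f) a = c *: dual_ract f a.
Proof. exact: dualP. Qed.
Let dractZr (c : K) f a : dual_ract f (c *: a) = c *: dual_ract f a.
Proof. by apply: dualP => x; rewrite dualZE /= lactZl linearZ. Qed.
Let dlactA a b f : dual_lact (amul a b) f = dual_lact a (dual_lact b f).
Proof. by apply: dualP => x; rewrite /= ractA. Qed.
Let dractA f a b : dual_ract f (amul a b) = dual_ract (dual_ract f a) b.
Proof. by apply: dualP => x; rewrite /= lactA. Qed.
Let dlractA a f b : dual_ract (dual_lact a f) b = dual_lact a (dual_ract f b).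
Proof. by apply: dualP => x; rewrite /= lractA. Qed.

Let dlact_continuous : continuous (fun p : A * X' => dual_lact p.1 p.2).
Proof.
have [C C0 rC] := ract_bounded X.
apply: (bilinear_bounded_continuous dlactDl dlactDr dlactZl dlactZr (C := C)).
move=> a f; apply: dual_norm_le => [|x]; first by rewrite !mulr_ge0.
apply: le_trans (le_dual_norm f _) _.
rewrite -dual_normE.
have -> : C * (`|a| * `|f|) * `|x| = `|f| * (C * (`|x| * `|a|)).
  by rewrite (mulrC `|a|) mulrCA -!mulrA (mulrC `|a|).
by rewrite ler_wpM2l.
Qed.

Let dract_continuous : continuous (fun p : X' * A => dual_ract p.1 p.2).
Proof.
have [C C0 lC] := lact_bounded X.
apply: (bilinear_bounded_continuous dractDl dractDr dractZl dractZr (C := C)).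
move=> f a; apply: dual_norm_le => [|x]; first by rewrite !mulr_ge0.
apply: le_trans (le_dual_norm f _) _.
rewrite -dual_normE.
have -> : C * (`|f| * `|a|) * `|x| = `|f| * (C * (`|a| * `|x|)).
  by rewrite mulrCA -!mulrA.
by rewrite ler_wpM2l.
Qed.

HB.instance Definition _ := CompleteNormedModule_isBanachBimodule.Build K A
  (dual X) dlactDl dlactDr dlactZl dlactZr dractDl dractDr dractZl dractZr
  dlactA dractA dlractA dlact_continuous dract_continuous.

Lemma dual_lactE (a : A) (f : X') x : lact a f x = f (ract x a).
Proof. by []. Qed.

Lemma dual_ractE (f : X') (a : A) x : ract f a x = f (lact a x).
Proof. by []. Qed.

End DualBimodule.

(* Main.v *)
(* Dualising 0 -> Y -> X -> X/Y -> 0 gives an exact sequence of bimodules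
   0 -> (X/Y)^* -> X^* -> Y^* -> 0, whose surjectivity on the right is the
   Hahn-Banach theorem. Given a derivation D into X^*, its restriction to Y is
   implemented by a functional on Y; extending that functional to f on X,
   D - ad f vanishes on Y, so it is a derivation into (X/Y)^* and is
   implemented by some h there. Hence D = ad (f + h o pi). *)
Require Import Defs.
From HB Require Import structures.
From mathcomp Require Import all_boot all_order all_algebra.
From mathcomp Require Import complex boolp classical_sets functions.
From mathcomp Require Import reals topology normedtype.
From mathcomp Require Import ring.

Set Implicit Arguments.
Unset Strict Implicit.
Unset Printing Implicit Defensive.

Import Order.TTheory GRing.Theory Num.Theory.
Import numFieldNormedType.Exports.

Local Open Scope classical_set_scope.
Local Open Scope ring_scope.

(** * The Hahn-Banach theorem for a sublinear functional on a real vector space *)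

Section HahnBanach.
Variables (R : realType) (V : lmodType R) (p : V -> R).
Hypothesis pD : forall x y, p (x + y) <= p x + p y.
Hypothesis pZ : forall c x, 0 <= c -> p (c *: x) = c * p x.

(* A linear relation [G] lying below the graph of [p] is automatically the graph
   of a partial function: [p 0 = 0] forces [r <= 0] and [- r <= 0] whenever
   [G (0, r)]. *)
Definition dominated_subspace (G : set (V * R^o)) : Prop :=
  (forall c u v, G u -> G v -> G (c *: u + v)) /\
  (forall u, G u -> u.2 <= p u.1).

Lemma dominated_subspace0 G : dominated_subspace G -> G !=set0 -> G 0.
Proof.
by move=> [Gl _] [u Gu]; have := Gl (-1) u u Gu Gu; rewrite scaleN1r addNr.
Qed.

Lemma dominated_subspaceZ G c u : dominated_subspace G -> G u -> G (c *: u).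
Proof.
move=> GP Gu; have G0 : G 0 by apply: dominated_subspace0 => //; exists u.
by rewrite -[_ *: _]addr0; apply: GP.1.
Qed.

Lemma dominated_subspace_functional G x r s : dominated_subspace G ->
  G (x, r) -> G (x, s) -> r = s.
Proof.
move=> [Gl Gp].
have le t t' : G (x, t) -> G (x, t') -> t' <= t.
  move=> Gt Gt'; have /Gp := Gl (-1) _ _ Gt Gt'.
  by rewrite /= !scaleN1r addNr -(scale0r 0) pZ// mul0r addrC subr_le0.
by move=> Gr Gs; apply/le_anti/andP; split; exact: le.
Qed.

(** A value [r] at [x] is admissible when [u.2 - p (u.1 - x) <= r <= p (v.1 + x) - v.2] for all [u],
    [v] in [G]. Such an [r] exists because [u.2 + v.2 <= p (u.1 + v.1) <= p (u.1 - x) + p (v.1 +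
    x)]. *)
Lemma dominated_subspace_extend G x : dominated_subspace G -> G !=set0 ->
  exists G', [/\ dominated_subspace G', G `<=` G' & exists r, G' (x, r)].
Proof.
move=> GP G0; have G00 := dominated_subspace0 GP G0; have [Gl Gp] := GP.
pose L := [set w.2 - p (w.1 - x) | w in G].
have Lub v : G v -> ubound L (p (v.1 + x) - v.2).
  move=> Gv _ [u Gu <-]; rewrite lerBlDr addrAC lerBrDr.
  have /Gp /= := Gl 1 _ _ Gu Gv; rewrite !scale1r => /le_trans; apply.
  apply: le_trans (pD _ _); rewrite [in leRHS]addrC.
  by have -> : u.1 - x + (v.1 + x) = u.1 + v.1 by rewrite addrACA addNr addr0.
have L0 : L !=set0 by exists (0 - p (0 - x)), 0.
have Lsup : has_sup L by split=> //; exists (p (0 + x) - 0); exact: Lub G00.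
pose r := sup L.
have rge u : G u -> u.2 - p (u.1 - x) <= r.
  by move=> Gu; apply: sup_upper_bound => //; exists u.
have rle u : G u -> r <= p (u.1 + x) - u.2.
  by move=> Gu; apply: ge_sup => //; exact: Lub.
pose G' := [set w | exists2 u, G u & exists c, w = u + c *: ((x, r) : V * R^o)].
exists G'; split; last by exists r, 0 => //; exists 1; rewrite add0r scale1r.
  split=> [d _ _ [u Gu [c ->]] [v Gv [e ->]]|_ [u Gu [c ->]]].
    exists (d *: u + v); first exact: Gl.
    by exists (d * c + e); rewrite scalerDr scalerDl scalerA addrACA.
  rewrite /= -[c *: r]/(c * r).
  (* Dividing by [|c|] reduces domination at [u + c *: (x, r)] to [rge] when [c < 0] and to [rle]
     when [c > 0]. *)
  have [c0|c0|->] := ltgtP c 0; last by rewrite scale0r mul0r !addr0; exact: Gp.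
    have d0 : 0 < - c by rewrite oppr_gt0.
    have := rge _ (dominated_subspaceZ (- c)^-1 GP Gu); rewrite /= => h.
    have := ler_wpM2l (ltW d0) h.
    rewrite mulrBr -pZ ?(ltW d0)// scalerBr scalerA mulfV ?gt_eqF// scale1r.
    rewrite -[_ *: u.2]/(_ * u.2) mulrA mulfV ?gt_eqF// mul1r scaleNr opprK.
    by rewrite mulNr lerBlDr addrC lerBrDr.
  have := rle _ (dominated_subspaceZ c^-1 GP Gu); rewrite /= => h.
  have := ler_wpM2l (ltW c0) h.
  rewrite mulrBr -pZ ?(ltW c0)// scalerDr scalerA mulfV ?gt_eqF// scale1r.
  rewrite -[_ *: u.2]/(_ * u.2) mulrA mulfV ?gt_eqF// mul1r.
  by rewrite lerBrDr addrC.
by move=> u Gu; exists u => //; exists 0; rewrite scale0r addr0.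
Qed.

(** The map [i] stands in for the inclusion of a subspace and may have a kernel: if [i y = 0], the
    bound at [y] and at [- y] forces [f y = 0]. *)
Theorem hahn_banach (U : lmodType R) (i : {linear U -> V})
    (f : {linear U -> R^o}) : (forall y, f y <= p (i y)) ->
  exists F : {linear V -> R^o}, (forall x, F x <= p x) /\ forall y, F (i y) = f y.
Proof.
move=> fp; pose G0 := range (fun y => (i y, f y)) : set (V * R^o).
have G0P : dominated_subspace G0.
  split=> [c _ _ [u _ <-] [v _ <-]|_ [u _ <-] //=].
  by exists (c *: u + v) => //; rewrite !linearP.
(* The guard [G !=set0] lets the empty set satisfy [P]: it is the union of the empty chain in Zorn's
   lemma. *)
pose P (G : set (V * R^o)) := dominated_subspace G /\ (G !=set0 -> G0 `<=` G).
have [F FP Ftot|G [[GP Gsub] Gmax]] := @Zorn_bigcup _ P.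
  split; last first.
    move=> [w [X FX Xw]] v G0v; exists X => //.
    by apply: (FP _ FX).2 => //; exists w.
  split=> [c u v [X FX Xu] [Z FZ Zv]|u [X FX Xu]]; last exact: (FP _ FX).1.2.
  have [XZ|ZX] := Ftot _ _ FX FZ.
    by exists Z => //; apply: (FP _ FZ).1.1 => //; exact: XZ.
  by exists X => //; apply: (FP _ FX).1.1 => //; exact: ZX.
(* If the maximal [G] were empty, [G0] would be strictly larger and still satisfy [P]. *)
have Gn0 : G !=set0.
  apply/set0P/eqP => G_eq0; apply: (Gmax G0); last by split=> // _ v.
  rewrite G_eq0; split=> // /(_ (i 0, f 0)); apply.
  by exists 0.
have G0G := Gsub Gn0.
(* Otherwise the extension of [G] by [x] would contradict maximality. *)
have Gtot x : exists r, G (x, r).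
  have [G' [G'P GG' [r G'r]]] := dominated_subspace_extend x GP Gn0.
  exists r; apply: contrapT => nGr; apply: (Gmax G').
    by split=> // /(_ _ G'r).
  by split=> // _; apply: subset_trans GG'.
have [F FG] := choice Gtot.
have Fl : linear (F : V -> R^o).
  move=> c x y; apply: (dominated_subspace_functional GP (FG _)).
  exact: GP.1 _ _ _ (FG x) (FG y).
pose FL := HB.pack_for {linear V -> R^o} (F : V -> R^o)
  (GRing.isLinear.Build _ _ _ _ _ Fl).
exists FL; split=> [x|y]; first exact: GP.2 _ (FG x).
by apply: (dominated_subspace_functional GP (FG _)); apply: G0G; exists y.
Qed.

End HahnBanach.

(** * Extension of bounded functionals over real and complex scalars *)

Lemma dual_extend_real (R : realType) (U : lmodType R) (X : normedModType R)
    (i : {linear U -> X}) (f : {linear U -> R^o}) (C : R) : 0 <= C ->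
  (forall y, `|f y| <= C * `|i y|) ->
  exists F : dual X, forall y, F (i y) = f y.
Proof.
move=> C0 fC.
have [|||F [Fp FE]] := @hahn_banach R X (fun x => C * `|x|) _ _ U i f.
- by move=> x y; rewrite -mulrDr ler_wpM2l// ler_normD.
- by move=> c x c0; rewrite normrZ ger0_norm// mulrCA.
- by move=> y; apply: le_trans (fC y); exact: ler_norm.
have FP : (F : X -> R^o) \in cfunctional_pred (X := X).
  apply: (@bounded_functional _ _ _ C); first exact: linearP.
  (* The seminorm is even, so the upper bound at [- x] is the lower bound at [x]. *)
  by move=> x; rewrite ler_norml Fp andbT lerNl -linearN -(normrN x) Fp.
by exists (Dual FP).
Qed.

Section Realification.
Variables (R : realType) (V : lmodType R[i]).

(** Restriction of scalars, placed on an alias of [V] so that the action of [R] does not compete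
    with that of [R[i]]. *)
Definition realify : Type := V.
HB.instance Definition _ := GRing.Zmodule.on realify.

Definition realify_scale (r : R) (x : realify) : realify :=
  (r%:C%C : R[i]) *: (x : V).

Let realify_scalerA a b x :
  realify_scale a (realify_scale b x) = realify_scale (a * b) x.
Proof. by rewrite /realify_scale scalerA rmorphM. Qed.
Let realify_scale1r : left_id 1 realify_scale.
Proof. exact: (@scale1r _ V). Qed.
Let realify_scalerDr : right_distributive realify_scale +%R.
Proof. by move=> r x y; exact: (@scalerDr _ V). Qed.
Let realify_scalerDl x : {morph realify_scale^~ x : a b / a + b}.
Proof. by move=> a b; rewrite /realify_scale rmorphD scalerDl. Qed.

HB.instance Definition _ := GRing.Zmodule_isLmodule.Build R realify
  realify_scalerA realify_scale1r realify_scalerDr realify_scalerDl.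

Lemma realify_scaleE (r : R) (x : realify) : r *: x = (r%:C%C : R[i]) *: (x : V).
Proof. by []. Qed.

End Realification.

(** A nonnegative element of [R[i]] has zero imaginary part. This moves norms into [R], where the
    dominating functional of [hahn_banach] takes its values. *)
Lemma normr_complexE (R : realType) (V : normedModType R[i]) (x : V) :
  `|x| = (complex.Re `|x|)%:C%C.
Proof.
have := normr_ge0 x; rewrite lecE /= => /andP[/eqP].
by case: `|x| => a b /= ->.
Qed.

(* Following Bohnenblust and Sobczyk, a complex linear functional is recovered
   from its real part [u] as [x |-> u x - i u (i x)]. *)
Lemma dual_extend_complex (R : realType) (U : lmodType R[i])
    (X : normedModType R[i]) (i : {linear U -> X}) (f : {linear U -> R[i]^o})
    (C : R[i]) : 0 <= C -> (forall y, `|f y| <= C * `|i y|) ->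
  exists F : dual X, forall y, F (i y) = f y.
Proof.
move=> C0 fC.
pose c := complex.Re C.
have CE : C = c%:C%C.
  by move: C0; rewrite lecE /= => /andP[/eqP]; rewrite /c; case: (C) => a b /= ->.
have c0 : 0 <= c by move: C0; rewrite CE lecR.
pose i' : realify U -> realify X := i.
have i'l : linear i' by move=> r x y; rewrite /i' !realify_scaleE linearP.
pose f' : realify U -> R^o := fun y => complex.Re (f y).
have ReD (z w : R[i]) : complex.Re (z + w) = complex.Re z + complex.Re w.
  by case: z w => ? ? [? ?].
have ReZ (r : R) (z : R[i]) : complex.Re (r%:C%C * z) = r * complex.Re z.
  by case: z => a b /=; rewrite mul0r subr0.
have f'l : linear f'.
  by move=> r x y; rewrite /f' realify_scaleE linearP ReD ReZ.
pose iL := HB.pack_for {linear realify U -> realify X} i'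
  (GRing.isLinear.Build _ _ _ _ _ i'l).
pose fL := HB.pack_for {linear realify U -> R^o} f'
  (GRing.isLinear.Build _ _ _ _ _ f'l).
pose p (x : realify X) : R := c * complex.Re `|x : X|.
have Re_le (z w : R[i]) : z <= w -> complex.Re z <= complex.Re w.
  by rewrite lecE => /andP[].
have [|||u [up uE]] := @hahn_banach R (realify X) p _ _ (realify U) iL fL.
- move=> x y; rewrite /p -mulrDr ler_wpM2l// -ReD; apply: Re_le.
  exact: (@ler_normD _ X).
- by move=> r x r0; rewrite /p realify_scaleE normrZ ger0_norm ?lecR// ReZ mulrCA.
- move=> y; rewrite /p -ReZ -CE; apply: le_trans (ler_norm _) _.
  exact: Re_le (le_trans (normc_ge_Re (f y)) (fC y)).
have uD (x y : X) : u (x + y) = u x + u y by exact: (linearD u).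
have uZ r (x : X) : u ((r%:C%C : R[i]) *: x) = r * u x by exact: (linearZ_LR u r x).
have uabs (x : X) : `|u x| <= p x.
  rewrite ler_norml up andbT lerNl -linearN (le_trans (up _))//.
  by rewrite /p (@normrN _ X).
pose F (x : X) : R[i]^o := (u x -i* u ((0 +i* 1)%C *: x))%C.
have Fl : linear F.
  move=> [a b] x y; rewrite /F.
  (* Since [u] is linear over [R] only, the scalar is split as [a + b i] and the products are
     expanded with [i * i = - 1]. *)
  have -> : (a +i* b)%C = a%:C%C + b%:C%C * (0 +i* 1)%C :> R[i].
    by apply/eqP; rewrite eq_complex /=; apply/andP; split; apply/eqP; ring.
  have II : (0 +i* 1)%C * (0 +i* 1)%C = - 1 :> R[i].
    by apply/eqP; rewrite eq_complex /=; apply/andP; split; apply/eqP; ring.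
  rewrite scalerDr scalerA mulrDr mulrCA II mulrN1 (mulrC _ a%:C%C).
  rewrite !scalerDl scaleNr -(scalerA a%:C%C) -(scalerA b%:C%C) !uD.
  have uN z : u (- z : X) = - u z by exact: (linearN u).
  rewrite uN !uZ; apply/eqP; rewrite eq_complex /=.
  by apply/andP; split; apply/eqP; ring.
have FP : F \in cfunctional_pred (X := X).
  (* The real and imaginary parts contribute [c] each, since [x] and [i x] have the same norm. *)
  apply: (@bounded_functional _ _ _ (c + c)%:C%C Fl) => x.
  apply: le_trans (complex_norm_le _) _; rewrite /= normrN (normr_complexE x) -rmorphM lecR.
  rewrite mulrDl lerD//; first exact: uabs.
  apply: le_trans (uabs _) _; rewrite /p normrZ.
  suff -> : `|(0 +i* 1)%C : R[i]| = 1 by rewrite mul1r.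
  by rewrite normc_def /= expr0n expr1n add0r sqrtr1.
exists (Dual FP) => y; rewrite /= /F.
have -> : (0 +i* 1)%C *: i y = i ((0 +i* 1)%C *: y) by rewrite linearZ.
(* The real part of [i * f y] is minus the imaginary part of [f y], so both parts of [f y] are
   recovered. *)
rewrite [u (i y)]uE [u (i _)]uE /= /f' linearZ /=.
by case: (f y) => a b /=; rewrite mul0r mul1r sub0r opprK.
Qed.

Lemma dual_extend (R : realType) (k : scalar_kind)
    (U : lmodType (scalars R k)) (X : normedModType (scalars R k))
    (i : {linear U -> X}) (f : {linear U -> (scalars R k)^o})
    (C : scalars R k) : 0 <= C ->
  (forall y, `|f y| <= C * `|i y|) ->
  exists F : dual X, forall y, F (i y) = f y.
Proof.
case: k U X i f C => U X i f C; first exact: dual_extend_real.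
exact: dual_extend_complex.
Qed.

(** * Bounded linear maps and inner derivations *)

Lemma continuous_linearP (K : numFieldType) (V W : normedModType K)
    (f : {linear V -> W}) :
  continuous f <-> exists2 C : K, 0 <= C & forall x, `|f x| <= C * `|x|.
Proof.
split=> [fc|[C C0 fC]].
  have /linear_boundedP/pinfty_ex_gt0[C C0 fC] : bounded_near f (nbhs (0 : V)).
    exact: continuous_linear_bounded (fc 0).
  by exists C => //; exact: ltW.
apply/linear_bounded_continuous/linear_boundedP.
near=> r => x; apply: le_trans (fC x) _; rewrite ler_wpM2r//.
by near: r; apply: nbhs_pinfty_ge; exact: ger0_real.
Unshelve. all: by end_near.
Qed.

Section InnerDerivation.
Variables (K : numFieldType) (A : banachAlgType K) (X : banachBimodType A).

Definition ad (x : X) (a : A) : X := lact a x - ract x a.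

Lemma ad_linear x : linear (ad x).
Proof.
move=> c a b; rewrite /ad lactDl ractDr lactZl ractZr scalerBr opprD.
by rewrite addrACA.
Qed.

HB.instance Definition _ x := GRing.isLinear.Build K A X *:%R (ad x) (ad_linear x).

Lemma derivation_ad x : derivation (ad x).
Proof.
split=> [|a b].
  have [C C0 lC] := lact_bounded X; have [E E0 rE] := ract_bounded X.
  apply/continuous_linearP; exists (C * `|x| + E * `|x|).
    by rewrite addr_ge0// mulr_ge0.
  move=> a; apply: le_trans (ler_normB _ _) _; rewrite mulrDl lerD//.
    by rewrite -mulrA (mulrC `|x|).
  by rewrite -mulrA.
(* In the Leibniz sum the two terms [a . x . b] have opposite signs and cancel. *)
rewrite /= /ad lactB ractB lactA ractA lractA.
by rewrite subrKA.
Qed.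

Lemma derivationB (D E : {linear A -> X}) :
  derivation D -> derivation E -> derivation (D \- E).
Proof.
move=> [Dc DM] [Ec EM]; split=> [a|a b /=]; first exact: cvgB (Dc a) (Ec a).
by rewrite DM EM lactB ractB opprD addrACA.
Qed.

End InnerDerivation.

(** * Restriction to [Y] and inflation from [X/Y] on dual modules *)

Section DualSequence.
Variables (R : realType) (k : scalar_kind).
Local Notation K := (scalars R k).
Variables (A : banachAlgType K) (X : banachBimodType A) (Y : closedSubbimod X).

Lemma dual_restrict_subproof (f : dual X) :
  (fun y : submod Y => f (submod_val y)) \in cfunctional_pred (X := submod Y).
Proof.
apply: (@bounded_functional _ _ _ `|f|) => [c y z|y].
  exact: (dual_linear f).
exact: le_dual_norm.
Qed.

Definition dual_restrict f : dual (submod Y) := Dual (dual_restrict_subproof f).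

Lemma dual_restrict_linear : linear dual_restrict.
Proof. by move=> c f g; apply: dualP. Qed.

HB.instance Definition _ :=
  GRing.isLinear.Build K (dual X) (dual (submod Y)) *:%R dual_restrict
    dual_restrict_linear.

Lemma ler_norm_dual_restrict f : `|dual_restrict f| <= `|f|.
Proof.
apply: dual_norm_le => [|y]; first exact: dual_norm_ge0.
by have := le_dual_norm f (submod_val y).
Qed.

Lemma dual_restrict_lact a f : dual_restrict (lact a f) = lact a (dual_restrict f).
Proof. exact: dualP. Qed.

Lemma dual_restrict_ract f a : dual_restrict (ract f a) = ract (dual_restrict f) a.
Proof. exact: dualP. Qed.

Lemma dual_restrict_surj (g : dual (submod Y)) : exists f, dual_restrict f = g.
Proof.
have [|y|f fE] := @dual_extend R k _ X (val : {linear submod Y -> X}) g `|g|.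
- exact: normr_ge0.
- exact: le_dual_norm.
- by exists f; apply: dualP.
Qed.

Lemma dual_inflate_subproof (g : dual (quomod Y)) :
  (fun x : X => g (quo_pi Y x)) \in cfunctional_pred (X := X).
Proof.
apply: (@bounded_functional _ _ _ `|g|) => [c x y|x].
  by rewrite quo_piD quo_piZ linearP.
apply: le_trans (le_dual_norm _ _) _.
by rewrite ler_wpM2l// ?dual_norm_ge0// quo_norm_le.
Qed.

Definition dual_inflate g : dual X := Dual (dual_inflate_subproof g).

Lemma dual_inflate_linear : linear dual_inflate.
Proof. by move=> c f g; apply: dualP. Qed.

HB.instance Definition _ :=
  GRing.isLinear.Build K (dual (quomod Y)) (dual X) *:%R dual_inflate
    dual_inflate_linear.

(** Follows from surjectivity of [quo_pi]; identities between functionals on the quotient can then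
    be checked in [dual X]. *)
Lemma dual_inflate_inj : injective dual_inflate.
Proof.
move=> g h gh; apply: dualP => q; rewrite -(quo_reprK q).
exact: (congr1 (fun f : dual X => f (quo_repr q)) gh).
Qed.

Lemma dual_inflate_lact a g : dual_inflate (lact a g) = lact a (dual_inflate g).
Proof. by apply: dualP => x; rewrite /= -quo_ractE. Qed.

Lemma dual_inflate_ract g a : dual_inflate (ract g a) = ract (dual_inflate g) a.
Proof. by apply: dualP => x; rewrite /= -quo_lactE. Qed.

(** Exactness in the middle: [f] is constant on the cosets of [Y]. The norm bound, obtained by
    taking the infimum over representatives, later gives continuity of the lifted derivation. *)
Lemma dual_descend (f : dual X) : dual_restrict f = 0 ->
  exists2 g, dual_inflate g = f & `|g| <= `|f|.
Proof.
move=> f0.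
have fpi x y : quo_pi Y x = quo_pi Y y -> f x = f y.
  move=> /quo_piP/asboolP Yxy; apply/eqP; rewrite -subr_eq0 -linearB; apply/eqP.
  exact: (congr1 (fun h : dual (submod Y) => h (Submod Yxy)) f0).
pose g (q : quomod Y) : K^o := f (quo_repr q).
have gpi x : g (quo_pi Y x) = f x by apply: fpi; rewrite quo_reprK.
have gl : linear g.
  move=> c p q; rewrite -(quo_reprK p) -(quo_reprK q) -quo_piZ -quo_piD !gpi.
  exact: dual_linear.
have gf q : `|g q| <= `|f| * `|q|.
  (* The infimum argument divides by the norm of [f], so norm zero is treated apart. *)
  have [f_eq0|f_neq0] := eqVneq `|f| 0.
    by have := le_dual_norm f (quo_repr q); rewrite -dual_normE f_eq0 !mul0r.
  have fp : 0 < `|f| by rewrite normr_gt0 -normr_eq0.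
  rewrite -ler_pdivrMl//; apply: quo_norm_ge => x <-.
  by rewrite ler_pdivrMl// gpi; exact: le_dual_norm.
exists (Dual (bounded_functional gl gf)); first exact: dualP.
exact: dual_norm_le.
Qed.

End DualSequence.

Theorem theorem1p6 (R : realType) (k : scalar_kind)
    (A : banachAlgType (scalars R k)) (X : banachBimodType A)
    (Y : closedSubbimod X) :
  H1_trivial A (dual (submod Y)) ->
  H1_trivial A (dual (quomod Y)) ->
  H1_trivial A (dual X).
Proof.
move=> HY HQ D Dder.
(* Restriction is a norm-decreasing bimodule map, so its composite with [D] is again a
   derivation. *)
have [|g gE] := HY (@dual_restrict _ _ _ _ Y \o D).
  split=> [|a b /=].
    apply/continuous_linearP; have [C C0 DC] := (continuous_linearP D).1 Dder.1.
    by exists C => // a; apply: le_trans (DC a); exact: ler_norm_dual_restrict.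
  by rewrite Dder.2 linearD /= dual_restrict_lact dual_restrict_ract.
have [f fg] := dual_restrict_surj g.
have [Ec EM] := derivationB Dder (derivation_ad f).
pose E : {linear A -> dual X} := D \- ad f.
have E0 a : dual_restrict Y (E a) = 0.
  rewrite /E /= linearB /= /ad linearB /= dual_restrict_lact dual_restrict_ract.
  by rewrite fg -gE subrr.
(* The lift of [E] is chosen pointwise: injectivity of [dual_inflate] yields its linearity and
   Leibniz rule, the norm bound its continuity. *)
have [G GE] : {G : A -> dual (quomod Y) &
    forall a, dual_inflate (G a) = E a /\ `|G a| <= `|E a|}.
  apply: (@choice _ _ (fun a h => dual_inflate h = E a /\ `|h| <= `|E a|)) => a.
  by have [h] := dual_descend (E0 a); exists h.
have Gl : linear G.
  move=> c a b; apply: dual_inflate_inj.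
  by rewrite linearP /= !(GE _).1 linearP.
pose GL := HB.pack_for {linear A -> dual (quomod Y)} G
  (GRing.isLinear.Build _ _ _ _ _ Gl).
have [|h hE] := HQ GL.
  split=> [|a b].
    apply/continuous_linearP; have [C C0 EC] := (continuous_linearP E).1 Ec.
    by exists C => // a; apply: le_trans (GE a).2 (EC a).
  apply: dual_inflate_inj; rewrite linearD /= dual_inflate_lact dual_inflate_ract.
  by rewrite !(GE _).1; exact: EM.
exists (f + dual_inflate h) => a.
have : E a = ad (dual_inflate h) a.
  rewrite -(GE a).1 [G a]hE linearB /=.
  by rewrite dual_inflate_lact dual_inflate_ract.
(* Here [D a] is [E a] plus [ad f a], and [ad] is additive in the functional. *)
move=> /= /eqP; rewrite subr_eq => /eqP ->; rewrite /ad.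
by rewrite lactDr ractDl opprD [RHS]addrACA [RHS]addrC.
Qed.
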